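(* Fix a finite number $E$ of observed environments $\mathcal{E}_{obs}=\{1,\dots,E\}$ and take the collection of environments of interest to be $\mathcal{E}=\mathcal{E}_{obs}$, with $p(e)$ the uniform distribution on $\mathcal{E}_{obs}$. In the setting described in the context, assume: (Invariance) there exists $z^*\in\{0,1\}^p$ such that $p_e(y\mid x^{z^*})$ is the same for all $e\in\mathcal{E}_{obs}$; (Uniqueness) this $z^*$ is unique; (Prior positivity) $p(z^* )>0$; (Estimation consistency given fixed environments) for every $z$ with $p(z)>0$, as $n\to\infty$, $$\frac{1}{nE}\sum_{i=1}^n\sum_{e=1}^E\log\hat p_e(y_{ei}\mid x_{ei}^z)\xrightarrow{P}\mathbb{E}_{p(e)p_e(y,x^z)}[\log p_e(y\mid x^z)],\qquad \frac{1}{nE}\sum_{i=1}^n\sum_{e=1}^E\log\hat g(y_{ei}\mid x_{ei}^z)\xrightarrow{P}\mathbb{E}_{p(e)p_e(y,x^z)}[\log g(y\mid x^z)].$$ Then, as $n\to\infty$ (with $E$ fixed): (i) $\hat z_{n,E}:=\arg\max_z\hat p(z\mid\mathcal{D})\xrightarrow{P}z^*$; and (ii) $\hat p(z^*\mid\mathcal{D})\xrightarrow{P}1$.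
   Context: Features $x\in\mathbb{R}^p$, outcome $y$. For $z\in\{0,1\}^p$, $x^z$ is the subvector of coordinates $j$ with $z^{(j)}=1$ and $x^{-z}$ the rest. Each environment $e$ has a joint density $p_e(x,y)$, from which $p_e(x^z)$, $p_e(y\mid x^z)$ are derived. The pooled conditional is $g(y\mid x^z):=\frac{\sum_{e=1}^E\int p_e(x,y)\,\mathrm{d}x^{-z}}{\sum_{e=1}^E p_e(x^z)}$. Data: in each environment $e=1,\dots,E$, $n$ i.i.d. observations $(x_{ei},y_{ei})$ drawn from $p_e(x,y)$; $\mathcal{D}$ is all data. A prior $p(z)$ on $\{0,1\}^p$ is given. For each $z$ a model class $\mathcal{P}_{y\mid x^z}$ is fixed; $\hat p_e(y\mid x^z)$ maximizes $\sum_{i=1}^n\log\tilde p(y_{ei}\mid x_{ei}^z)$ and $\hat g(y\mid x^z)$ maximizes $\sum_{e=1}^E\sum_{i=1}^n\log\tilde p(y_{ei}\mid x_{ei}^z)$ over $\tilde p\in\mathcal{P}_{y\mid x^z}$. The estimated BIP posterior is $\hat p(z\mid\mathcal{D})\propto p(z)\prod_{e=1}^E\prod_{i=1}^n\frac{\hat g(y_{ei}\mid x_{ei}^z)}{\hat p_e(y_{ei}\mid x_{ei}^z)}$. *)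

(* Defs.v *)
From HB Require Import structures.
From mathcomp Require Import all_boot all_order all_algebra.
From mathcomp Require Import all_classical all_reals all_analysis.
Set Implicit Arguments.
Unset Strict Implicit.
Unset Printing Implicit Defensive.
Import Order.TTheory GRing.Theory Num.Theory.
Import numFieldNormedType.Exports.
Local Open Scope classical_set_scope.
Local Open Scope ring_scope.

(* Variable selections z in {0,1}^p.  Coordinate j of x belongs to x^z  *)
(* iff z j = true.  Features x live in R^p (= p.-tuple R), outcome y in R. *)
Definition selector (p : nat) := {ffun 'I_p -> bool}.

Definition upd {R : realType} {p : nat} (x : p.-tuple R) (j : 'I_p) (t : R)
  : p.-tuple R := [tuple if i == j then t else tnth x i | i < p].

(* Iterated Lebesgue integral over the coordinates listed in S (the other
   coordinates are those of the base point x). This is Lebesgue integration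
   over R^S (Tonelli) for the nonnegative integrands used below. *)
Fixpoint iint {R : realType} {p : nat} (S : seq 'I_p)
    (f : p.-tuple R -> \bar R) (x : p.-tuple R) : \bar R :=
  match S with
  | [::] => f x
  | j :: S' => (\int[@lebesgue_measure R]_t iint S' f (upd x j t))%E
  end.

Definition tuple0 {R : realType} {p : nat} : p.-tuple R := [tuple 0 | _ < p].

Definition lebXY {R : realType} {p : nat} (h : p.-tuple R * R -> \bar R)
  : \bar R :=
  (\int[@lebesgue_measure R]_y iint (enum 'I_p) (fun x => h (x, y)) tuple0)%E.

Definition leb_null {R : realType} {p : nat} (N : set (p.-tuple R * R)) :=
  measurable N /\ lebXY (fun w => (\1_N w)%:E) = 0%E.

Definition outz {p : nat} (z : selector p) : seq 'I_p :=
  [seq j <- enum 'I_p | ~~ z j].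

(* joint density of (x^z, y):  \int p_e(x,y) dx^{-z}  (a function of x^z, y) *)
Definition jointz {R : realType} {p : nat} (pe : p.-tuple R * R -> R)
    (z : selector p) (w : p.-tuple R * R) : R :=
  fine (iint (outz z) (fun x' => (pe (x', w.2))%:E) w.1).

Definition margz {R : realType} {p : nat} (pe : p.-tuple R * R -> R)
    (z : selector p) (x : p.-tuple R) : R :=
  fine (iint (outz z) (fun x' => \int[@lebesgue_measure R]_y (pe (x', y))%:E)%E x).

Definition condz {R : realType} {p : nat} (pe : p.-tuple R * R -> R)
    (z : selector p) (w : p.-tuple R * R) : R :=
  jointz pe z w / margz pe z w.1.

Definition pooled {R : realType} {p E : nat} (pe : 'I_E -> p.-tuple R * R -> R)
    (z : selector p) (w : p.-tuple R * R) : R :=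
  (\sum_(e < E) jointz (pe e) z w) / (\sum_(e < E) margz (pe e) z w.1).

(* Invariance: p_e(y | x^z) is the same for all environments, i.e. for all
   e, e' the two conditional densities agree (Lebesgue-a.e.) wherever both
   are defined (both marginals of x^z positive). *)
Definition env_invariant {R : realType} {p E : nat}
    (pe : 'I_E -> p.-tuple R * R -> R) (z : selector p) : Prop :=
  forall e e' : 'I_E, exists N, leb_null N /\
    forall w, 0 < margz (pe e) z w.1 -> 0 < margz (pe e') z w.1 -> ~ N w ->
      condz (pe e) z w = condz (pe e') z w.

Definition has_density {R : realType} {p : nat}
    (mu : probability (p.-tuple R * R)%type R) (pe : p.-tuple R * R -> R) :=
  [/\ forall w, 0 <= pe w, measurable_fun setT pe &
      forall A, measurable A -> mu A = lebXY (fun w => (pe w * \1_A w)%:E)].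

Definition Eenv {R : realType} {p E : nat}
    (mu : 'I_E -> probability (p.-tuple R * R)%type R)
    (f : 'I_E -> p.-tuple R * R -> R) : R :=
  E%:R^-1 * \sum_(e < E) Rintegral (mu e) setT (f e).

Definition is_cond_density {R : realType} {p : nat} (z : selector p)
    (q : p.-tuple R -> R -> R) : Prop :=
  [/\ forall x y, 0 <= q x y,
      forall x x', (forall j, z j -> tnth x j = tnth x' j) -> q x = q x',
      forall x, measurable_fun setT (q x) &
      forall x, (\int[@lebesgue_measure R]_y (q x y)%:E)%E = 1%E].

Definition elog {R : realType} (t : R) : \bar R :=
  if 0 < t then (ln t)%:E else -oo%E.

Definition cvg_in_prob {R : realType} {d : measure_display}
    {Omega : measurableType d} (P : probability Omega R)
    (X : nat -> Omega -> \bar R) (l : R) : Prop :=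
  forall eps : R, 0 < eps ->
    (fun n => P [set w | (eps%:E <= `| X n w - l%:E |)%E]) @ \oo --> 0%E.

Definition indep_data {R : realType} {d d' : measure_display}
    {Omega : measurableType d} {T : measurableType d'}
    (P : probability Omega R) {E n : nat} (X : 'I_E -> 'I_n -> Omega -> T) :=
  forall A : 'I_E -> 'I_n -> set T, (forall e i, measurable (A e i)) ->
    fine (P [set w | forall e i, A e i (X e i w)]) =
    \prod_(e < E) \prod_(i < n) fine (P (X e i @^-1` A e i)).

Definition bip_weight {R : realType} {p E n : nat} {Omega : Type}
    (prior : selector p -> R)
    (phat : 'I_E -> selector p -> nat -> Omega -> p.-tuple R -> R -> R)
    (ghat : selector p -> nat -> Omega -> p.-tuple R -> R -> R)
    (X : 'I_E -> 'I_n -> Omega -> p.-tuple R * R) (w : Omega) (z : selector p)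
  : R :=
  prior z * \prod_(e < E) \prod_(i < n)
    (ghat z n w (X e i w).1 (X e i w).2 / phat e z n w (X e i w).1 (X e i w).2).

Definition bip_post {R : realType} {p E n : nat} {Omega : Type}
    (prior : selector p -> R)
    (phat : 'I_E -> selector p -> nat -> Omega -> p.-tuple R -> R -> R)
    (ghat : selector p -> nat -> Omega -> p.-tuple R -> R -> R)
    (X : 'I_E -> 'I_n -> Omega -> p.-tuple R * R) (w : Omega) (z : selector p)
  : R :=
  bip_weight prior phat ghat X w z /
  \sum_(z' : selector p) bip_weight prior phat ghat X w z'.

(* Main.v *)
Require Import Defs.
From HB Require Import structures.
From mathcomp Require Import all_boot all_order all_algebra.
From mathcomp Require Import all_classical all_reals all_analysis.
From mathcomp Require Import finmap measurable_realfun lra ring.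
Import Order.TTheory GRing.Theory Num.Theory.
Import numFieldNormedType.Exports.
Local Open Scope classical_set_scope.
Local Open Scope ring_scope.

Set Implicit Arguments.
Unset Strict Implicit.
Unset Printing Implicit Defensive.

(** For fixed z let j_e, m_e be the densities of (x^z, y) and x^z in environment
    e, c_e = j_e / m_e, and g = (sum_e j_e) / (sum_e m_e). By log t <= t - 1,
    E_e[log c_e - log g] >= E_e[1 - g / c_e], and E_e[g / c_e] is the integral
    of g m_e over {j_e > 0}; since sum_e g m_e <= sum_e j_e, the gaps
    E_e[log c_e - log g] sum to a nonnegative number. If the sum is 0, then
    g / c_e = 1 almost surely and g m_e = 0 a.e. on {j_e = 0}, so that c_e = g
    a.e. on {m_e > 0} for every e and z is invariant. Conversely, invariance
    makes c_e = g almost surely, so the gap vanishes at z*. By consistency,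
    1/(nE) times the logarithm of the likelihood ratio of z is close to minus
    the average gap; hence every z <> z* is exponentially negligible with respect to z*. *)

(** * Iterated Lebesgue integrals over lists of coordinates *)

Section coordinate_integrals.
Context {R : realType} {p : nat}.
Local Notation T := (p.-tuple R * R)%type.
Implicit Types (H K : T -> \bar R) (S : seq (option 'I_p)) (w : T).

(** The outcome y is treated as one more coordinate, with index [None]. *)
Definition updT w (k : option 'I_p) (t : R) : T :=
  if k is Some j then (upd w.1 j t, w.2) else (w.1, t).

Fixpoint cint S H w : \bar R :=
  if S is k :: S' then
    (\int[@lebesgue_measure R]_t cint S' H (updT w k t))%E
  else H w.

Definition nnmeas H := measurable_fun setT H /\ forall w, (0 <= H w)%E.

Definition free_of S {U : Type} (K : T -> U) :=
  forall w k t, k \in S -> K (updT w k t) = K w.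

Lemma tnth_upd (x : p.-tuple R) j t i :
  tnth (upd x j t) i = if i == j then t else tnth x i.
Proof. by rewrite tnth_mktuple. Qed.

Lemma updT_idem w k s t : updT (updT w k s) k t = updT w k t.
Proof.
case: k => [j|//]; congr pair; apply: eq_from_tnth => i /=.
by rewrite !tnth_upd; case: eqP.
Qed.

Lemma updT_comm w k l s t : k != l ->
  updT (updT w k s) l t = updT (updT w l t) k s.
Proof.
case: k l => [j|] [l|]//= jl; congr pair; apply: eq_from_tnth => i /=.
rewrite !tnth_upd; case: eqP => [->|//]; case: eqP => // lj.
by rewrite lj eqxx in jl.
Qed.

Lemma measurable_updT k : measurable_fun setT (fun u : T * R => updT u.1 k u.2).
Proof.
have m1 : measurable_fun setT (fun u : T * R => u.1.1).
  by apply: (measurableT_comp measurable_fst); exact: measurable_fst.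
have m2 : measurable_fun setT (fun u : T * R => u.1.2).
  by apply: (measurableT_comp measurable_snd); exact: measurable_fst.
case: k => [j|]; apply: measurable_fun_pair => //=.
apply/measurable_fun_tnthP => i.
rewrite (_ : _ \o _ = fun u : T * R => if i == j then u.2 else tnth u.1.1 i);
  last by apply/funext => u /=; rewrite tnth_upd.
case: eqP => _; first exact: measurable_snd.
exact: (measurableT_comp (measurable_tnth i)).
Qed.

Lemma measurable_updTr w k : measurable_fun setT (updT w k).
Proof. exact: measurable_fun_pair2 (measurable_updT k). Qed.

Lemma cint_nnmeas S H : nnmeas H -> nnmeas (cint S H).
Proof.
move=> mH; elim: S => //= k S [mS S0]; split => [|w]; last first.
  exact: integral_ge0.
pose f (u : T * R) := cint S H (updT u.1 k u.2).
have mf : measurable_fun setT f := measurableT_comp mS (measurable_updT k).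
exact: (measurable_fun_fubini_tonelli_F (T2 := measurableTypeR R)
  (m2 := @lebesgue_measure R) f mf (fun u => S0 _)).
Qed.

Lemma measurable_cint_updT S H w k : nnmeas H ->
  measurable_fun (T := measurableTypeR R) setT (fun t => cint S H (updT w k t)).
Proof.
move=> /cint_nnmeas-/(_ S)[mS _].
exact: (measurableT_comp mS (measurable_updTr w k)).
Qed.
Hint Resolve measurable_cint_updT : core.

Lemma cint_ge0 S H w : nnmeas H -> (0 <= cint S H w)%E.
Proof. by move=> /cint_nnmeas-/(_ S)[]. Qed.
Hint Resolve cint_ge0 : core.

Lemma le_cint S H K w : nnmeas H -> nnmeas K -> (forall w, H w <= K w)%E ->
  (cint S H w <= cint S K w)%E.
Proof.
move=> mH mK HK; elim: S w => //= k S ih w.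
apply: ge0_le_integral => //.
- by move=> t _; exact: cint_ge0.
- exact: measurable_cint_updT.
- exact: measurable_cint_updT.
Qed.

Lemma eq_cint S H K w : (forall w, H w = K w) -> cint S H w = cint S K w.
Proof. by move=> /funext ->. Qed.

Lemma nnmeasD H K : nnmeas H -> nnmeas K -> nnmeas (fun w => H w + K w)%E.
Proof.
move=> [mH H0] [mK K0]; split => [|w]; [exact: emeasurable_funD|exact: adde_ge0].
Qed.

Lemma nnmeasM H K : nnmeas H -> nnmeas K -> nnmeas (fun w => H w * K w)%E.
Proof.
move=> [mH H0] [mK K0]; split => [|w]; [exact: emeasurable_funM|exact: mule_ge0].
Qed.

Lemma nnmeas_cst (c : \bar R) : (0 <= c)%E -> nnmeas (cst c).
Proof. by move=> c0; split. Qed.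

Lemma nnmeas_sum I (s : seq I) (F : I -> T -> \bar R) :
  (forall i, nnmeas (F i)) -> nnmeas (fun w => \sum_(i <- s) F i w)%E.
Proof.
move=> mF; split=> [|w]; last by apply: sume_ge0 => i _; have [_] := mF i.
by apply: emeasurable_sum => i; have [] := mF i.
Qed.

Lemma cintD S H K w : nnmeas H -> nnmeas K ->
  (cint S (fun w => H w + K w) w = cint S H w + cint S K w)%E.
Proof.
move=> mH mK; elim: S w => //= k S ih w.
under eq_integral do rewrite ih.
rewrite ge0_integralD//;
  by first [exact: measurable_cint_updT|move=> t _; exact: cint_ge0].
Qed.

Lemma cint_sum S I (s : seq I) (F : I -> T -> \bar R) w :
  (forall i, nnmeas (F i)) ->
  (cint S (fun w => \sum_(i <- s) F i w) w = \sum_(i <- s) cint S (F i) w)%E.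
Proof.
move=> mF; elim: S w => //= k S ih w.
under eq_integral do rewrite ih.
rewrite ge0_integral_sum// => [i|i x _]; [exact: measurable_cint_updT|exact: cint_ge0].
Qed.

(** Every integration variable lies in [S], so [K] is constant in it. [K] may take the value [+oo];
    the choice [cst +oo] is used below to turn statements about supports into inequalities. *)
Lemma cintZl S H K w : nnmeas H -> (forall w, 0 <= K w)%E -> free_of S K ->
  (cint S (fun w => K w * H w) w = K w * cint S H w)%E.
Proof.
move=> mH K0; elim: S w => //= k S ih w SK.
have SK' : free_of S K by move=> ? ? ? kS; apply: SK; rewrite inE kS orbT.
under eq_integral do rewrite (ih _ SK') SK ?mem_head//.
by rewrite ge0_integralZl//; [exact: measurable_cint_updT|move=> *; exact: cint_ge0].
Qed.

Lemma cint_limn S (F : nat -> T -> \bar R) w : (forall n, nnmeas (F n)) ->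
  (forall w, {homo F ^~ w : m n / (m <= n)%N >-> (m <= n)%E}) ->
  cint S (fun w => limn (F ^~ w)) w = limn (fun n => cint S (F n) w).
Proof.
move=> mF ndF; elim: S w => //= k S ih w.
under eq_integral do rewrite ih.
apply: monotone_convergence => //.
- by move=> n; exact: measurable_cint_updT.
- by move=> n x _; exact: cint_ge0.
- by move=> x _ m n mn; apply: le_cint => // w'; exact: ndF.
Qed.

Lemma cint_cat S1 S2 H w : cint (S1 ++ S2) H w = cint S1 (cint S2 H) w.
Proof. by elim: S1 w => //= k S ih w; apply: eq_integral => t _; exact: ih. Qed.

(** Tonelli for the two outermost variables, since updates of distinct coordinates commute. *)
Lemma cint_swap k l S H w : nnmeas H -> k != l ->
  cint [:: k, l & S] H w = cint [:: l, k & S] H w.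
Proof.
move=> mH kl /=.
have mS : measurable_fun setT
    (fun u : R * R => cint S H (updT (updT w k u.1) l u.2)).
  have [mS _] := cint_nnmeas S mH; apply: (measurableT_comp mS).
  have m1 : measurable_fun setT (fun u : R * R => updT w k u.1).
    exact: (measurableT_comp (measurable_updTr w k) measurable_fst).
  exact: (measurableT_comp (measurable_updT l)
    (measurable_fun_pair m1 measurable_snd)).
rewrite (@fubini_tonelli _ _ (measurableTypeR R) (measurableTypeR R) R
  (@lebesgue_measure R) (@lebesgue_measure R) _ mS) /= => [|x];
  last exact: cint_ge0.
by apply: eq_integral => t _; apply: eq_integral => s _; rewrite updT_comm.
Qed.

Lemma cint_perm S1 S2 H w : nnmeas H -> uniq S1 -> perm_eq S1 S2 ->
  cint S1 H w = cint S2 H w.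
Proof.
move=> mH; elim: S1 S2 w => [|k S1 ih] S2 w.
  by move=> _; rewrite perm_sym => /perm_nilP ->.
move=> /= /andP[kS1 uS1] pS.
have kS2 : k \in S2 by rewrite -(perm_mem pS) mem_head.
have [A [B S2E]] : exists A B, S2 = A ++ k :: B.
  by case/splitPr: kS2 => A B; exists A, B.
rewrite {kS2}S2E in pS *.
have pAB : perm_eq S1 (A ++ B).
  by rewrite -(perm_cons k) (perm_trans pS)// -cat_rcons -cats1 -catA perm_catCA.
have kA : k \notin A.
  by apply/negP => kA; move: kS1; rewrite (perm_mem pAB) mem_cat kA.
(* The tails agree by induction; it remains to carry [k] past the entries of [A] by adjacent swaps,
   all of distinct coordinates since [k] is not in [A]. *)
transitivity (cint (k :: A ++ B) H w).
  by apply: eq_integral => t _; exact: ih.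
elim: A kA {ih uS1 pS pAB} w => //= a A ih.
rewrite inE negb_or => /andP[ka kA] w.
rewrite -/(cint [:: k, a & A ++ B] H w) cint_swap//.
by apply: eq_integral => t _; exact: ih.
Qed.

(** Moving [k] to the front makes its integral the outermost one, and that integration variable
    overwrites any earlier value of the coordinate. *)
Lemma cint_free S H : nnmeas H -> uniq S -> free_of S (cint S H).
Proof.
move=> mH uS w k t kS.
rewrite !(cint_perm _ mH uS (perm_to_rem kS)) /=.
by under eq_integral do rewrite updT_idem.
Qed.

End coordinate_integrals.

(** * Densities on the full space and integration against them *)

Section densities.
Context {R : realType} {p : nat}.
Local Notation T := (p.-tuple R * R)%type.
Implicit Types (H K : T -> \bar R) (S : seq (option 'I_p)) (w : T).

(** The mass lost by [fine], which sends [+oo] to [0]: densities such as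
    [jointz] are truncated in this way where the integral over the remaining
    coordinates diverges. *)
Definition infpart H w : \bar R := if H w == +oo%E then +oo%E else 0%E.

Lemma infpartE H w : (0 <= H w)%E -> H w = ((fine (H w))%:E + infpart H w)%E.
Proof.
rewrite /infpart; case: eqP => [->//|/eqP Hoo H0].
by rewrite adde0 fineK// ge0_fin_numE// ltey.
Qed.

Lemma nnmeas_infpart H : nnmeas H -> nnmeas (infpart H).
Proof.
move=> [mH H0]; split => [|w]; last by rewrite /infpart; case: ifP.
apply: measurable_fun_ifT => //.
apply: (measurable_fun_bool true).
rewrite setTI (_ : _ @^-1` _ = H @^-1` [set +oo%E]).
  by rewrite -[_ @^-1` _]setTI; apply: mH.
by apply/seteqP; split => w /= /eqP.
Qed.

Lemma nnmeas_fine H : nnmeas H -> nnmeas (fun w => (fine (H w))%:E).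
Proof.
move=> [mH H0]; split => [|w]; last by rewrite lee_fin fine_ge0.
by apply/measurable_EFinP; apply: measurableT_comp mH; exact: fine_measurable.
Qed.

(** A finite integral forces the set where [H] is infinite to be null, so truncating by [fine] loses
    no mass. *)
Lemma cint_infpart S H w : nnmeas H -> (cint S H w < +oo)%E ->
  cint S (infpart H) w = 0%E.
Proof.
move=> mH Hoo.
have mI := nnmeas_infpart mH.
(* Being +oo times itself, the integral is either 0 or +oo. *)
have E : cint S (infpart H) w = (+oo * cint S (infpart H) w)%E.
  rewrite -(cintZl (K := cst +oo%E))//; last by move=> *; exact: leey.
  by apply: eq_cint => v; rewrite /infpart; case: ifP; rewrite ?mule0 ?mulyy.
have lt : (cint S (infpart H) w < +oo)%E.
  apply: le_lt_trans Hoo; apply: le_cint => // v.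
  by rewrite /infpart; case: eqP => [->//|_]; have [] := mH.
have := cint_ge0 S w mI; rewrite le_eqVlt => /orP[/eqP <-//|gt0].
by move: lt; rewrite E gt0_mulye// ltxx.
Qed.

Lemma iint_cint (S : seq 'I_p) H w :
  iint S (fun x => H (x, w.2)) w.1 = cint (map Some S) H w.
Proof.
elim: S w => [[]//|j S ih w] /=.
by apply: eq_integral => t _; rewrite -ih.
Qed.

Definition coords : seq (option 'I_p) := None :: map Some (enum 'I_p).

(** A placeholder: the integrals started here run over every coordinate that the integrand depends
    on. *)
Definition base : T := (Defs.tuple0, 0).

Lemma lebXY_cint H : lebXY H = cint coords H base.
Proof. by apply: eq_integral => y _; exact: (iint_cint _ _ (Defs.tuple0, y)). Qed.

Lemma nnmeas_EFin (f : T -> R) : measurable_fun setT f -> (forall w, 0 <= f w) ->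
  nnmeas (EFin \o f).
Proof.
by move=> mf f0; split => [|w]; [exact/measurable_EFinP|rewrite lee_fin].
Qed.

Lemma nnmeas_indic (A : set T) : measurable A -> nnmeas (fun w => (\1_A w)%:E).
Proof. by move=> mA; apply: nnmeas_EFin => //; exact: measurable_indic. Qed.

Section density_integral.
Import HBNNSimple.
Variables (mu : probability T R) (f : T -> R).
Hypothesis muf : has_density mu f.

Let nnmeas_f : nnmeas (EFin \o f).
Proof. by case: muf => f0 mf _; exact: nnmeas_EFin. Qed.

Let integral_nnsfun_density (h : {nnsfun T >-> R}) :
  (\int[mu]_w (h w)%:E = cint coords (fun w => (f w)%:E * (h w)%:E) base)%E.
Proof.
have [f0 mf muE] := muf.
set s := finmap.enum_fset (fset_set (range h)).
have s0 (i : 'I_(size s)) : 0 <= s`_i.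
  have : s`_i \in fset_set (range h) by exact: mem_nth.
  by rewrite in_fset_set// => /set_mem[x _ <-].
have hE w : (h w)%:E =
    (\sum_(i < size s) (s`_i)%:E * (\1_(h @^-1` [set s`_i]) w)%:E)%E.
  by rewrite sumEFin (fimfunEord h).
have mI i : nnmeas (fun w => (\1_(h @^-1` [set s`_i]) w)%:E).
  by apply: nnmeas_indic; exact: measurable_sfunP.
under eq_integral do rewrite hE.
rewrite ge0_integral_sum//; last first.
- by move=> i x _; rewrite mule_ge0 ?lee_fin.
- by move=> i; apply: measurable_funeM; case: (mI i).
transitivity (cint coords (fun w => \sum_(i < size s)
    ((s`_i)%:E * ((f w)%:E * (\1_(h @^-1` [set s`_i]) w)%:E)))%E base); last first.
  apply: eq_cint => w; rewrite hE ge0_sume_distrr.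
    by apply: eq_bigr => i _; rewrite muleCA.
  by move=> i _; rewrite mule_ge0 ?lee_fin.
have mfI i : nnmeas (fun w => ((f w)%:E * (\1_(h @^-1` [set s`_i]) w)%:E)%E).
  exact: nnmeasM.
rewrite cint_sum; last first.
  move=> i; apply: nnmeasM => //.
  by apply: (@nnmeas_cst _ _ (s`_i)%:E); rewrite lee_fin.
apply: eq_bigr => i _.
rewrite ge0_integralZl//; [|by case: (mI i)|by rewrite lee_fin].
rewrite (cintZl (K := cst (s`_i)%:E))//; last by move=> *; rewrite lee_fin.
congr (_ * _)%E; rewrite integral_indic// setIT.
apply: (etrans (muE _ _)); first exact: measurable_sfunP.
by rewrite lebXY_cint; apply: eq_cint => w; rewrite EFinM.
Qed.

(** The defining identity on measurable sets extends to simple functions by linearity, then to [H]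
    by monotone convergence along an increasing simple approximation. *)
Lemma integral_density H : nnmeas H ->
  (\int[mu]_w H w = cint coords (fun w => (f w)%:E * H w) base)%E.
Proof.
move=> [mH H0]; have [f0 mf _] := muf.
pose h := nnsfun_approx measurableT mH.
have cvgh w : (EFin \o h ^~ w) n @[n --> \oo] --> H w.
  by apply: (@cvg_nnsfun_approx _ _ _ setT).
have ndh w : {homo (fun n => (h n w)%:E) : m n / (m <= n)%N >-> (m <= n)%E}.
  by move=> m n mn; rewrite lee_fin; exact/lefP/nd_nnsfun_approx.
have HE : H = fun w => limn (fun n => (h n w)%:E).
  by apply/funext => w; apply/esym/cvg_lim => //; exact: cvgh.
have mh n : nnmeas (fun w => (h n w)%:E) by exact: nnmeas_EFin.
transitivity (limn (fun n => \int[mu]_w (h n w)%:E))%E.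
  rewrite {1}HE; apply: monotone_convergence => //.
  - by move=> n; case: (mh n).
  - by move=> n w _; case: (mh n).
transitivity (limn (fun n => cint coords (fun w => (f w)%:E * (h n w)%:E) base)%E).
  by congr (limn _); apply/funext => n; exact: integral_nnsfun_density.
rewrite -cint_limn; last 2 first.
- by move=> n; exact: nnmeasM.
- by move=> w m n mn; apply: lee_wpmul2l; [rewrite lee_fin|exact: ndh].
apply: eq_cint => w; apply/cvg_lim => //.
by apply: cvgeZl => //; exact: cvgh.
Qed.

End density_integral.

End densities.

(** Inversion is [expR (- ln t)] for [t > 0], and the convention [0^-1 = 0] settles the remaining
    value. *)
Lemma measurable_funV_ge0 d (T : measurableType d) (R : realType) (f : T -> R) :
  measurable_fun setT f -> (forall x, 0 <= f x) ->
  measurable_fun setT (fun x => (f x)^-1).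
Proof.
move=> mf f0.
rewrite (_ : (fun x => _) = fun x => if 0 < f x then expR (- ln (f x)) else 0).
  apply: measurable_fun_ifT => //; first exact: measurable_fun_ltr.
  apply: (measurableT_comp (@measurable_expR R)).
  apply: (measurable_funN (f := fun x => ln (f x))).
  exact: (measurableT_comp (@measurable_ln R)).
apply/funext => x; case: ifPn => [fx|]; first by rewrite expRN lnK.
by rewrite lt0r f0 andbT negbK => /eqP ->; rewrite invr0.
Qed.

(** * Marginalisation onto the selected coordinates *)

Section selected_coordinates.
Context {R : realType} {p : nat}.
Local Notation T := (p.-tuple R * R)%type.
Variables (f : T -> R) (mu : probability T R) (z : selector p).
Hypothesis muf : has_density mu f.

(** [outc] lists the coordinates of x^{-z}, [inyc] those of (x^z, y). *)
Definition outc : seq (option 'I_p) := map Some (outz z).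
Definition inyc : seq (option 'I_p) := None :: map Some [seq j <- enum 'I_p | z j].

Let nnmeas_f : nnmeas (EFin \o f).
Proof. by case: muf => f0 mf _; exact: nnmeas_EFin. Qed.

Lemma uniq_outc : uniq outc.
Proof.
rewrite map_inj_uniq => [|? ? []//].
by apply: filter_uniq; exact: enum_uniq.
Qed.

Lemma perm_coords : perm_eq coords (inyc ++ outc).
Proof.
rewrite /coords /inyc /outc /= perm_cons -map_cat perm_map// perm_sym.
by rewrite (permEl (perm_filterC _ _)).
Qed.

Lemma uniq_coords : uniq (@coords p).
Proof.
rewrite /coords /= map_inj_uniq ?enum_uniq ?andbT => [|? ? []//].
by apply/mapP => -[].
Qed.

Let J := cint outc (EFin \o f).
Let M := cint [:: None] J.

Let nnmeas_J : nnmeas J. Proof. exact: cint_nnmeas. Qed.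
Let nnmeas_M : nnmeas M. Proof. exact: cint_nnmeas. Qed.

Lemma jointzE w : jointz f z w = fine (cint outc (EFin \o f) w).
Proof. by congr fine; exact: (iint_cint (outz z) (EFin \o f) w). Qed.

Lemma uniq_Noutc : uniq (None :: outc).
Proof. by rewrite /= uniq_outc andbT; apply/mapP => -[]. Qed.

(** [margz] has y innermost; Tonelli makes it outermost. Truncation by [fine] happens once, after
    both integrations, so the inner function is the untruncated joint density rather than
    [jointz]. *)
Lemma margzE w :
  margz f z w.1 = fine (cint [:: None] (cint outc (EFin \o f)) w).
Proof.
congr fine; rewrite -(cint_cat [:: None]).
rewrite (cint_perm (S2 := outc ++ [:: None]) w nnmeas_f uniq_Noutc); last first.
  by rewrite cats1 perm_sym perm_rcons.
by rewrite cint_cat; exact: (iint_cint (outz z) (cint [:: None] (EFin \o f)) w).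
Qed.

Lemma nnmeas_jointz : nnmeas (EFin \o jointz f z).
Proof.
rewrite (_ : _ \o _ = fun w => (fine (J w))%:E); last first.
  by apply/funext => w /=; rewrite jointzE.
exact: nnmeas_fine.
Qed.

Lemma nnmeas_margz : nnmeas (fun w => (margz f z w.1)%:E).
Proof.
rewrite (_ : (fun w => _) = fun w => (fine (M w))%:E); last first.
  by apply/funext => w /=; rewrite margzE.
exact: nnmeas_fine.
Qed.

Lemma jointz_ge0 (w : T) : 0 <= jointz f z w.
Proof. by have [_ /(_ w)] := nnmeas_jointz; rewrite lee_fin. Qed.

Lemma margz_ge0 (w : T) : 0 <= margz f z w.1.
Proof. by have [_ /(_ w)] := nnmeas_margz; rewrite lee_fin. Qed.

Lemma measurable_jointz : measurable_fun setT (jointz f z).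
Proof. by have [/measurable_EFinP] := nnmeas_jointz. Qed.

Lemma measurable_margz : measurable_fun setT (fun w : T => margz f z w.1).
Proof. by have [/measurable_EFinP] := nnmeas_margz. Qed.

Lemma condz_ge0 (w : T) : 0 <= condz f z w.
Proof. by rewrite divr_ge0 ?jointz_ge0 ?margz_ge0. Qed.

Lemma measurable_condz : measurable_fun setT (condz f z).
Proof.
apply: measurable_funM; first exact: measurable_jointz.
by apply: measurable_funV_ge0; [exact: measurable_margz|exact: margz_ge0].
Qed.

Lemma free_jointz : free_of outc (jointz f z).
Proof.
by move=> w k t kS; rewrite !jointzE (cint_free nnmeas_f uniq_outc _ _ kS).
Qed.

Lemma free_margz : free_of (None :: outc) (fun w => margz f z w.1).
Proof.
move=> w k t kS; rewrite !margzE -!(cint_cat [:: None]).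
by rewrite (cint_free nnmeas_f uniq_Noutc _ _ kS).
Qed.

Lemma cint_joint_mass : cint inyc J base = 1%E.
Proof.
rewrite -cint_cat -(cint_perm _ nnmeas_f uniq_coords perm_coords).
have [_ _ /(_ setT measurableT)] := muf.
rewrite lebXY_cint probability_setT => ->.
by apply: eq_cint => w /=; rewrite indicT mulr1.
Qed.

Lemma le_cint_jointz :
  (cint inyc (EFin \o jointz f z) base <= 1)%E.
Proof.
rewrite -cint_joint_mass; apply: le_cint => //; first exact: nnmeas_jointz.
move=> w /=; rewrite jointzE [leRHS](infpartE (cint_ge0 _ w nnmeas_f)) leeDl//.
by have [_] := nnmeas_infpart nnmeas_J.
Qed.

(** Integrating x^{-z} first pulls out [K] and leaves the untruncated joint density, that is
    [jointz] plus an infinite part. The latter contributes nothing because the total mass is 1, even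
    against a [K] that takes the value [+oo]. *)
Lemma integral_reduced (K : T -> \bar R) : nnmeas K -> free_of outc K ->
  (\int[mu]_w K w = cint inyc (fun w => K w * (jointz f z w)%:E) base)%E.
Proof.
move=> mK fK; rewrite (integral_density muf mK).
have mJI := nnmeas_infpart nnmeas_J.
rewrite (cint_perm _ _ uniq_coords perm_coords); last exact: nnmeasM.
rewrite cint_cat.
transitivity (cint inyc
    (fun w => K w * (jointz f z w)%:E + K w * infpart J w) base)%E.
  apply: eq_cint => w; under eq_cint do rewrite muleC.
  rewrite cintZl//; last by case: mK.
  rewrite -ge0_muleDr ?lee_fin ?jointz_ge0//; last by case: mJI.
  by rewrite jointzE -infpartE// cint_ge0.
rewrite cintD; [|by apply: nnmeasM => //; exact: nnmeas_jointz|exact: nnmeasM].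
suff -> : cint inyc (fun w => K w * infpart J w)%E base = 0%E by rewrite adde0.
have le0 : (cint inyc (fun w => K w * infpart J w) base <= 0)%E.
  have <- : (cint inyc (fun w => cst +oo%E w * infpart J w) base = 0)%E.
    rewrite cintZl//; last by move=> *; exact: leey.
    by rewrite cint_infpart ?mule0// cint_joint_mass ltry.
  apply: le_cint => [||w].
  - exact: nnmeasM.
  - by apply: nnmeasM => //; apply: nnmeas_cst; exact: leey.
  - by apply: lee_wpmul2r; [case: mJI|exact: leey].
by apply/le_anti/andP; split => //; apply: cint_ge0; exact: nnmeasM.
Qed.

Lemma prob_reduced (Q : set T) : measurable Q -> free_of outc (\1_Q : T -> R) ->
  mu Q = cint inyc (fun w => (\1_Q w * jointz f z w)%:E) base.
Proof.
move=> mQ fQ; rewrite -(setIT Q) -integral_indic// integral_reduced ?setIT//.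
- exact: nnmeas_indic.
- by move=> w k t kS; rewrite fQ.
Qed.

End selected_coordinates.

Lemma measurable_set_bool d (T : measurableType d) (q : T -> bool) :
  measurable_fun setT q -> measurable [set x | q x].
Proof.
move=> mq; rewrite (_ : [set x | _] = setT `&` q @^-1` [set true]).
  exact: mq.
by rewrite setTI; apply/seteqP; split => x /=.
Qed.

Lemma indic_bool (R : pzRingType) T (q : T -> bool) x :
  \1_[set y | q y] x = (q x)%:R :> R.
Proof.
rewrite indicE; suff -> : (x \in [set y | q y]) = q x by [].
by apply/idP/idP => [/set_mem|qx]; [|exact: mem_set].
Qed.

(** * Almost sure positivity of the joint and marginal densities *)

Section positivity.
Context {R : realType} {p : nat}.
Local Notation T := (p.-tuple R * R)%type.
Variables (f : T -> R) (mu : probability T R) (z : selector p).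
Hypothesis muf : has_density mu f.

Let nnmeas_f : nnmeas (EFin \o f).
Proof. by case: muf => f0 mf _; exact: nnmeas_EFin. Qed.

Lemma cint0 S (w : T) : cint S (fun _ => 0%E) w = 0%E.
Proof.
elim: S w => //= k S ih w.
by under eq_integral do rewrite ih; rewrite integral0.
Qed.

(** The event [jointz f z w = 0] depends on (x^z, y) only, so its probability is the integral of
    [jointz] over it. *)
Lemma jointz_ae_gt0 : {ae mu, forall w, 0 < jointz f z w}.
Proof.
pose q w := jointz f z w == 0.
have mq : measurable [set w | q w].
  apply: measurable_set_bool; apply: measurable_fun_eqr => //.
  exact: measurable_jointz muf.
exists [set w | q w]; split => //; last first.
  move=> w /= /negP; rewrite -leNgt => j0.
  by rewrite /q eq_le j0 (jointz_ge0 z muf).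
have fq : free_of (outc z) (\1_[set w | q w] : T -> R).
  by move=> w k t kS; rewrite !indic_bool /q (free_jointz muf).
apply: (etrans (prob_reduced muf mq fq)).
rewrite -[RHS](cint0 (inyc z) base); apply: eq_cint => w.
by rewrite indic_bool /q; case: eqP => [->|]; rewrite ?mulr0 ?mul0r.
Qed.

(** The exceptional event depends on x^z only. Integrating y first over it gives the untruncated
    marginal, which is 0 or [+oo] there, as [fine] sends both to 0; the value [+oo] occurs on a null
    set only, because the mass is finite. *)
Lemma margz_ae_gt0 : {ae mu, forall w, 0 < margz f z w.1}.
Proof.
pose q (w : T) := margz f z w.1 == 0.
have mq : measurable [set w | q w].
  apply: measurable_set_bool; apply: measurable_fun_eqr => //.
  exact: measurable_margz muf.
exists [set w | q w]; split => //; last first.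
  move=> w /= /negP; rewrite -leNgt => j0.
  by rewrite /q eq_le j0 (margz_ge0 z muf).
have fq k : k \in None :: outc z -> forall w t,
    \1_[set w | q w] (updT w k t) = \1_[set w | q w] w :> R.
  by move=> kS w t; rewrite !indic_bool /q (free_margz muf).
have fq' : free_of (outc z) (\1_[set w | q w] : T -> R).
  by move=> w k t kS; rewrite fq// inE kS orbT.
apply: (etrans (prob_reduced muf mq fq')).
set J := cint (outc z) (EFin \o f).
have mJ : nnmeas J by exact: cint_nnmeas.
set M := cint [:: None] J.
have mM : nnmeas M by exact: cint_nnmeas.
have m1 := nnmeas_indic mq.
set A := map Some [seq j <- enum 'I_p | z j].
(* With y as the innermost of the remaining variables, its integral produces [M]. *)
have pA : perm_eq (inyc z) (A ++ [:: None]) by rewrite cats1 perm_sym perm_rcons.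
have uA : uniq (inyc z).
  by have := @uniq_coords p; rewrite (perm_uniq (perm_coords z)) cat_uniq => /andP[].
have mI := nnmeas_infpart mM.
have MI : cint A (infpart M) base = 0%E.
  apply: cint_infpart => //.
  by rewrite -cint_cat -(cint_perm _ mJ uA pA) (cint_joint_mass z muf) ltry.
have m1J : nnmeas (fun w => ((\1_[set w0 | q w0] w)%:E * J w)%E).
  exact: nnmeasM.
have m1j : nnmeas (fun w => (\1_[set w0 | q w0] w * jointz f z w)%:E).
  exact: (nnmeasM m1 (nnmeas_jointz z muf)).
apply/le_anti/andP; split; last first.
  exact: cint_ge0.
apply: (@le_trans _ _ (cint (inyc z)
  (fun w => (\1_[set w | q w] w)%:E * J w)%E base)).
  apply: le_cint => //.
  move=> w; rewrite EFinM; apply: lee_wpmul2l => //.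
  rewrite jointzE [leRHS](infpartE (cint_ge0 _ w nnmeas_f)) leeDl//.
  by have [_] := nnmeas_infpart mJ.
rewrite (cint_perm _ _ uA pA)// cint_cat -MI; apply: le_cint => //.
  exact: cint_nnmeas.
move=> w; rewrite cintZl//; last first.
  by move=> v k t; rewrite inE => /eqP ->; rewrite fq// mem_head.
rewrite indic_bool /q; case: eqP => [m0|_]; last by rewrite mul0e; case: mI.
have [_ /(_ w) M0] := mM; rewrite mul1e -/M [leLHS](infpartE M0).
by move: m0; rewrite (margzE _ muf) -/M => ->; rewrite add0e.
Qed.

End positivity.

(** * The pooled conditional and its ratio to the environment conditionals *)

Section pooled_conditional.
Context {R : realType} {p E : nat}.
Local Notation T := (p.-tuple R * R)%type.
Variables (pe : 'I_E -> T -> R) (mu : 'I_E -> probability T R) (z : selector p).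
Hypothesis mupe : forall e, has_density (mu e) (pe e).

Local Notation j e := (jointz (pe e) z).
Local Notation m e := (margz (pe e) z).
Local Notation c e := (condz (pe e) z).
Local Notation g := (pooled pe z).

Let j0 e (w : T) : 0 <= j e w. Proof. exact: jointz_ge0 (mupe e) _. Qed.
Let m0 e (w : T) : 0 <= m e w.1. Proof. exact: margz_ge0 (mupe e) _. Qed.
Let c0 e (w : T) : 0 <= c e w. Proof. exact: condz_ge0 (mupe e) _. Qed.
Let mj e : measurable_fun setT (j e). Proof. exact: measurable_jointz. Qed.
Let mm e : measurable_fun setT (fun w : T => m e w.1).
Proof. exact: measurable_margz. Qed.
Let mc e : measurable_fun setT (c e). Proof. exact: measurable_condz. Qed.

Lemma pooled_ge0 w : 0 <= g w.
Proof. by rewrite divr_ge0 ?sumr_ge0. Qed.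

Lemma measurable_pooled : measurable_fun setT g.
Proof.
apply: measurable_funM; first exact: measurable_sum.
apply: measurable_funV_ge0; first exact: measurable_sum.
by move=> w; rewrite sumr_ge0.
Qed.

Lemma free_condz e : free_of (outc z) (c e).
Proof.
move=> w k t kS; rewrite /condz (free_jointz (mupe e))//.
by rewrite (free_margz (mupe e))// inE kS orbT.
Qed.

Lemma free_pooled : free_of (outc z) g.
Proof.
move=> w k t kS; rewrite /pooled; congr (_ / _); apply: eq_bigr => e _.
  by rewrite (free_jointz (mupe e)).
by rewrite (free_margz (mupe e))// inE kS orbT.
Qed.

Definition ratio e w := g w / c e w.

Lemma ratio_ge0 e w : 0 <= ratio e w.
Proof. by rewrite divr_ge0 ?pooled_ge0. Qed.

Lemma measurable_ratio e : measurable_fun setT (ratio e).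
Proof.
apply: measurable_funM; first exact: measurable_pooled.
exact: measurable_funV_ge0.
Qed.

Lemma free_ratio e : free_of (outc z) (ratio e).
Proof. by move=> w k t kS; rewrite /ratio free_pooled// free_condz. Qed.

(** The part of the integral of g m_e that E_e[g / c_e] does not see; it detects
    where c_e = 0 but g > 0. *)
Definition defect e w := (j e w == 0)%:R * (g w * m e w.1).

Lemma nnmeas_defect e : nnmeas (EFin \o defect e).
Proof.
apply: nnmeas_EFin => [|w]; last by rewrite mulr_ge0 ?ler0n// mulr_ge0// pooled_ge0.
apply: measurable_funM; last exact: measurable_funM measurable_pooled _.
rewrite (_ : (fun w => _) = \1_[set w | j e w == 0]).
  by apply: measurable_indic; apply: measurable_set_bool; exact: measurable_fun_eqr.
by apply/funext => w; rewrite indic_bool.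
Qed.

(** Pointwise, [ratio] times [j e] plus [defect] equals [g] times [m e]: the first term covers [j e]
    nonzero, the second [j e] zero. Summed over e this is at most the sum of the joint densities,
    trivially so where all marginals vanish, and each of these has integral at most 1. *)
Lemma sum_ratio_defect_le :
  (\sum_(e < E) (\int[mu e]_w (ratio e w)%:E +
     cint (inyc z) (EFin \o defect e) base) <= E%:R%:E)%E.
Proof.
have nr e : nnmeas (EFin \o ratio e).
  apply: nnmeas_EFin; first exact: measurable_ratio.
  by move=> w; exact: ratio_ge0.
have nj e : nnmeas (EFin \o j e) by exact: nnmeas_EFin.
have ngm e : nnmeas (fun w => (g w * m e w.1)%:E).
  apply: nnmeas_EFin; first exact: measurable_funM measurable_pooled _.
  by move=> w; rewrite mulr_ge0 ?pooled_ge0.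
have -> : (\sum_(e < E) (\int[mu e]_w (ratio e w)%:E +
      cint (inyc z) (EFin \o defect e) base) =
    \sum_(e < E) cint (inyc z) (fun w => (g w * m e w.1)%:E) base)%E.
  apply: eq_bigr => e _.
  have fr : free_of (outc z) (EFin \o ratio e).
    by move=> w k t kS /=; rewrite free_ratio.
  have -> := integral_reduced (mupe e) (nr e) fr.
  have nrj := nnmeasM (nr e) (nj e).
  apply: (etrans (esym (cintD _ _ nrj (nnmeas_defect e)))).
  apply: eq_cint => w /=; rewrite -EFinM -EFinD; congr EFin.
  rewrite /ratio /defect /condz invf_div; case: eqP => [->|/eqP jn0].
    by rewrite !mulr0 add0r mul1r.
  by rewrite mul0r addr0 mulrA mulfVK.
rewrite -cint_sum//.
apply: (@le_trans _ _ (cint (inyc z) (fun w => \sum_(e < E) (j e w)%:E)%E base)).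
  apply: le_cint; [exact: nnmeas_sum|exact: nnmeas_sum|move=> w].
  rewrite !sumEFin lee_fin -mulr_sumr /pooled.
  have [->|mn0] := eqVneq (\sum_(e < E) m e w.1) 0; last by rewrite divfK.
  by rewrite mulr0 sumr_ge0.
rewrite cint_sum//.
apply: (@le_trans _ _ (\sum_(e < E) 1%E)%E).
  by apply: lee_sum => e _; exact: le_cint_jointz.
by rewrite sumEFin sumr_const card_ord.
Qed.

End pooled_conditional.

(** * Logarithmic inequalities and the information gap *)

Lemma ln_le_subr1 (R : realType) (x : R) : 0 < x -> ln x <= x - 1.
Proof.
move=> x0; rewrite lerBrDl -[leRHS]lnK//; exact: expR_ge1Dx.
Qed.

Lemma ln_eq_subr1 (R : realType) (x : R) : 0 < x -> ln x = x - 1 -> x = 1.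
Proof.
move=> x0 lx; apply/eqP; rewrite -ln_eq0//; apply/negPn/negP => /expR_gt1Dx.
by rewrite lnK// lx subrKC ltxx.
Qed.

Section information_gap.
Context {R : realType} {p E : nat}.
Local Notation T := (p.-tuple R * R)%type.
Variables (pe : 'I_E -> T -> R) (mu : 'I_E -> probability T R) (z : selector p).
Hypothesis mupe : forall e, has_density (mu e) (pe e).
Hypothesis int_condz : forall e,
  (mu e).-integrable setT (fun w => (ln (condz (pe e) z w))%:E).
Hypothesis int_pooled : forall e,
  (mu e).-integrable setT (fun w => (ln (pooled pe z w))%:E).

Local Notation j e := (jointz (pe e) z).
Local Notation m e := (margz (pe e) z).
Local Notation c e := (condz (pe e) z).
Local Notation g := (pooled pe z).
Local Notation r e := (ratio pe z e).

Let j0 e (w : T) : 0 <= j e w. Proof. exact: jointz_ge0 (mupe e) _. Qed.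
Let m0 e (w : T) : 0 <= m e w.1. Proof. exact: margz_ge0 (mupe e) _. Qed.

Lemma pooled_gt0 e w : 0 < j e w -> 0 < m e w.1 -> 0 < g w.
Proof.
move=> je me; apply: divr_gt0; rewrite (bigD1 e)//= ltr_wpDr// sumr_ge0//.
Qed.

Lemma ae_gt0 e :
  {ae mu e, forall w, [/\ 0 < j e w, 0 < m e w.1, 0 < c e w & 0 < g w]}.
Proof.
apply: filterS2 (jointz_ae_gt0 z (mupe e)) (margz_ae_gt0 z (mupe e)) => w je me.
by split => //; [exact: divr_gt0|exact: pooled_gt0 je me].
Qed.

Let Z e := cint (inyc z) (EFin \o defect pe z e) base.
Let I e := (\int[mu e]_w (r e w)%:E)%E.

Let Z0 e : (0 <= Z e)%E.
Proof. by apply: cint_ge0; exact: nnmeas_defect. Qed.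

Let I0 e : (0 <= I e)%E.
Proof. by apply: integral_ge0 => w _; rewrite lee_fin (ratio_ge0 z mupe). Qed.

Let IZ_le e : (I e + Z e <= E%:R%:E)%E.
Proof.
apply: le_trans (sum_ratio_defect_le z mupe).
rewrite (bigD1 e)//= leeDl// sume_ge0// => i _; apply: adde_ge0; first exact: I0.
exact: Z0.
Qed.

Let Z_fin e : Z e \is a fin_num.
Proof.
rewrite ge0_fin_numE//; apply: (@le_lt_trans _ _ E%:R%:E); last exact: ltry.
by apply: le_trans (IZ_le e); rewrite leeDr.
Qed.

Let I_fin e : I e \is a fin_num.
Proof.
rewrite ge0_fin_numE//; apply: (@le_lt_trans _ _ E%:R%:E); last exact: ltry.
by apply: le_trans (IZ_le e); rewrite leeDl.
Qed.

Lemma fin_num_defect e : cint (inyc z) (EFin \o defect pe z e) base \is a fin_num.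
Proof. exact: Z_fin. Qed.

Lemma integrable_ratio e : (mu e).-integrable setT (EFin \o r e).
Proof.
apply/integrableP; split; first by apply/measurable_EFinP; exact: measurable_ratio.
under eq_integral do rewrite /= ger0_norm ?(ratio_ge0 z mupe)//.
by have := I_fin e; rewrite ge0_fin_numE.
Qed.

Definition gap e := Rintegral (mu e) setT (fun w => ln (c e w)) -
  Rintegral (mu e) setT (fun w => ln (g w)).

(** t - 1 - log t at t = g / c_e. *)
Definition excess e w := r e w - 1 + (ln (c e w) - ln (g w)).

Let int_ln e : (mu e).-integrable setT (EFin \o (fun w => ln (c e w) - ln (g w))).
Proof.
exact: (integrableB measurableT (int_condz e) (int_pooled e)).
Qed.

Let int_1 e : (mu e).-integrable setT (EFin \o cst (1 : R)).
Proof. exact: finite_measure_integrable_cst. Qed.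

Let int_r1 e : (mu e).-integrable setT (EFin \o (fun w => r e w - 1)).
Proof. exact: (integrableB measurableT (integrable_ratio e) (int_1 e)). Qed.

Lemma integrable_excess e : (mu e).-integrable setT (EFin \o excess e).
Proof. exact: (integrableD measurableT (int_r1 e) (int_ln e)). Qed.

Lemma Rintegral_excess e :
  Rintegral (mu e) setT (excess e) = Rintegral (mu e) setT (r e) - 1 + gap e.
Proof.
rewrite (RintegralD measurableT (int_r1 e) (int_ln e)).
rewrite (RintegralB measurableT (integrable_ratio e) (int_1 e)).
rewrite (RintegralB measurableT (int_condz e) (int_pooled e)).
congr (_ - _ + _); have -> // : Rintegral (mu e) setT (cst (1 : R)) = fine 1%E.
congr fine; apply: (etrans (integral_cst _ measurableT 1%E)).
by rewrite mul1e; exact: probability_setT.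
Qed.

Lemma excess_ge0 e w : 0 < c e w -> 0 < g w ->
  0 <= excess e w /\ (excess e w = 0 -> r e w = 1).
Proof.
move=> ce gw; have re : 0 < r e w by exact: divr_gt0.
have -> : excess e w = r e w - 1 - ln (r e w).
  by rewrite /excess /ratio ln_div ?posrE// opprB.
split; first by rewrite subr_ge0 ln_le_subr1.
by move=> /eqP; rewrite subr_eq0 => /eqP/esym; exact: ln_eq_subr1.
Qed.

(** [excess e] is known to be nonnegative only where [c e] and [g] are positive, hence almost
    surely. With the absolute value, a zero integral yields almost sure vanishing. *)
Lemma Rintegral_excess_norm e :
  Rintegral (mu e) setT (excess e) = Rintegral (mu e) setT (fun w => `|excess e w|).
Proof.
congr fine; have mex := measurable_int _ (integrable_excess e).
apply: ae_eq_integral => //.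
  by apply/measurable_EFinP; apply: measurableT_comp => //; exact/measurable_EFinP.
apply: filterS (ae_gt0 e) => w [_ _ ce gw] _.
by rewrite ger0_norm//; case: (excess_ge0 ce gw).
Qed.

(** The integral of [excess e] is that of the ratio, minus 1, plus [gap e]. Summing over e, the
    bound [E] on ratios and defects together compensates the terms -1. *)
Lemma sum_gap_ge : \sum_(e < E) Rintegral (mu e) setT (fun w => `|excess e w|) +
  \sum_(e < E) fine (cint (inyc z) (EFin \o defect pe z e) base) <=
  \sum_(e < E) gap e.
Proof.
under eq_bigr do rewrite -Rintegral_excess_norm Rintegral_excess.
rewrite !big_split/= sumrN sumr_const card_ord.
have : \sum_(e < E) Rintegral (mu e) setT (r e) + \sum_(e < E) fine (Z e) <= E%:R.
  rewrite -big_split/= -lee_fin -sumEFin.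
  apply: le_trans (sum_ratio_defect_le z mupe); apply: lee_sum => e _.
  by rewrite EFinD /Rintegral !fineK//; exact: I_fin.
by rewrite /Z; lra.
Qed.

End information_gap.

(** * Null sets for Lebesgue measure and for the environment laws *)

Section null_sets.
Context {R : realType} {p : nat}.
Local Notation T := (p.-tuple R * R)%type.

(** The factor [+oo] encodes inclusion of supports: since [+oo * 0 = 0], the pointwise bound says
    that [H] vanishes wherever [K] does. *)
Lemma cint_le0_eq0 S (H K : T -> \bar R) w : nnmeas H -> nnmeas K ->
  (forall v, (H v <= +oo * K v)%E) -> cint S K w = 0%E -> cint S H w = 0%E.
Proof.
move=> mH mK HK K0; apply/le_anti/andP; split; last exact: cint_ge0.
rewrite -(mule0 +oo%E) -K0 -(cintZl (K := cst +oo%E))//; last first.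
  by move=> *; exact: leey.
apply: le_cint => //; apply: (nnmeasM (H := cst +oo%E)) => //.
by apply: nnmeas_cst; exact: leey.
Qed.

Lemma leb_nullU (A B : set T) : leb_null A -> leb_null B -> leb_null (A `|` B).
Proof.
rewrite /leb_null !lebXY_cint => -[mA A0] [mB B0]; split; first exact: measurableU.
have nA := nnmeas_indic mA; have nB := nnmeas_indic mB.
apply: (cint_le0_eq0 (K := fun w => ((\1_A w)%:E + (\1_B w)%:E)%E)).
- by apply: nnmeas_indic; exact: measurableU.
- exact: nnmeasD.
- move=> w; rewrite !indicE in_setU.
  case: (w \in A); case: (w \in B) => /=; rewrite -?EFinD ?addr0 ?add0r ?mule0//;
    by rewrite gt0_mulye ?leey// lte_fin.
- by rewrite cintD// A0 B0 adde0.
Qed.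

Lemma leb_null_prob (f : T -> R) (mu : probability T R) (N : set T) :
  has_density mu f -> leb_null N -> mu.-negligible N.
Proof.
rewrite /leb_null lebXY_cint => -[f0 mf muE] [mN N0]; exists N; split => //.
apply: (etrans (muE _ mN)); rewrite lebXY_cint; move: N0; apply: cint_le0_eq0.
- apply: nnmeas_EFin; first by apply: measurable_funM => //; exact: measurable_indic.
  by move=> w; rewrite mulr_ge0.
- exact: nnmeas_indic.
- move=> w; rewrite indicE; case: (w \in N); last by rewrite mulr0 mule0.
  by rewrite mule1 leey.
Qed.

End null_sets.

(** * Vanishing gap and invariance *)

Section invariance.
Context {R : realType} {p E : nat}.
Local Notation T := (p.-tuple R * R)%type.
Variables (pe : 'I_E -> T -> R) (mu : 'I_E -> probability T R) (z : selector p).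
Hypothesis mupe : forall e, has_density (mu e) (pe e).
Hypothesis int_condz : forall e,
  (mu e).-integrable setT (fun w => (ln (condz (pe e) z w))%:E).
Hypothesis int_pooled : forall e,
  (mu e).-integrable setT (fun w => (ln (pooled pe z w))%:E).

Local Notation j e := (jointz (pe e) z).
Local Notation m e := (margz (pe e) z).
Local Notation c e := (condz (pe e) z).
Local Notation g := (pooled pe z).
Local Notation r e := (ratio pe z e).

Let j0 e (w : T) : 0 <= j e w. Proof. exact: jointz_ge0 (mupe e) _. Qed.
Let m0 e (w : T) : 0 <= m e w.1. Proof. exact: margz_ge0 (mupe e) _. Qed.
Let mj e : measurable_fun setT (j e). Proof. exact: measurable_jointz. Qed.
Let mm e : measurable_fun setT (fun w : T => m e w.1).
Proof. exact: measurable_margz. Qed.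
Let mc e : measurable_fun setT (c e). Proof. exact: measurable_condz. Qed.
Let mg : measurable_fun setT g. Proof. exact: measurable_pooled. Qed.

Let excess_sum_ge0 :
  0 <= \sum_(e < E) Rintegral (mu e) setT (fun w => `|excess pe z e w|).
Proof. by apply: sumr_ge0 => e _; apply: Rintegral_ge0. Qed.

Let defect_ge0 e : 0 <= fine (cint (inyc z) (EFin \o defect pe z e) base).
Proof. by apply: fine_ge0; apply: cint_ge0; exact: nnmeas_defect. Qed.

Section zero_gap.
Hypothesis gap0 : \sum_(e < E) gap pe mu z e <= 0.

Let sum0 : \sum_(e < E) Rintegral (mu e) setT (fun w => `|excess pe z e w|) = 0 /\
  \sum_(e < E) fine (cint (inyc z) (EFin \o defect pe z e) base) = 0.
Proof.
have := le_trans (sum_gap_ge mupe int_condz int_pooled) gap0.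
have : 0 <= \sum_(e < E) fine (cint (inyc z) (EFin \o defect pe z e) base).
  by apply: sumr_ge0.
by move: excess_sum_ge0; split; lra.
Qed.

(** A zero sum of nonnegative reals vanishes termwise; finiteness excludes an infinite defect hidden
    by [fine]. *)
Lemma cint_defect0 e : cint (inyc z) (EFin \o defect pe z e) base = 0%E.
Proof.
have /eqP := sum0.2; rewrite psumr_eq0//.
move=> /allP/(_ e (mem_index_enum e))/eqP.
by move=> d0; rewrite -[LHS]fineK ?d0//; exact: (fin_num_defect z mupe).
Qed.

Lemma ratio_ae1 e : {ae mu e, forall w, r e w = 1}.
Proof.
have /eqP := sum0.1; rewrite psumr_eq0; last by move=> *; exact: Rintegral_ge0.
move=> /allP/(_ e (mem_index_enum e))/eqP ex0.
have iex := integrable_excess mupe int_condz int_pooled e.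
have mex := measurable_int _ iex.
have : (\int[mu e]_w `|(EFin \o excess pe z e) w|)%E = 0%E.
  rewrite -[LHS]fineK; first by rewrite -[fine _]/(Rintegral _ _ _) ex0.
  by have /integrableP[_] := iex; rewrite ge0_fin_numE//; exact: integral_ge0.
move=> /(ae_eq_integral_abs _ measurableT mex).1 ex.
apply: filterS2 ex (ae_gt0 z mupe e) => w /(_ I)[ew] [_ _ ce gw].
exact: (excess_ge0 ce gw).2.
Qed.

(** On this set, if [j e] is positive then the ratio differs from 1, which is almost surely
    excluded; if [j e] is 0 then [c e] is 0 and [g] is positive, so the defect is positive although
    its integral is 0. *)
Lemma condz_pooled_null e :
  leb_null [set w | (0 < m e w.1) && (c e w != g w)].
Proof.
set q := fun w : T => (0 < m e w.1) && (c e w != g w).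
set s := fun w : T => (r e w != 1) && (0 < m e w.1).
have mlt : measurable_fun setT (fun w : T => 0 < m e w.1).
  exact: measurable_fun_ltr.
have mN : measurable [set w | q w].
  apply: measurable_set_bool; apply: measurable_and => //.
  by apply: measurable_neg; exact: measurable_fun_eqr.
have mS : measurable [set w | s w].
  apply: measurable_set_bool; apply: measurable_and => //.
  by apply: measurable_neg; apply: measurable_fun_eqr => //; exact: measurable_ratio.
have fN : free_of (outc z) (fun w => (\1_[set w | q w] w)%:E : \bar R).
  move=> w k t kS; rewrite !indic_bool /q (free_condz mupe)// (free_pooled mupe)//.
  by rewrite (free_margz (mupe e))// inE kS orbT.
have fS : free_of (outc z) (\1_[set w | s w] : T -> R).
  move=> w k t kS; rewrite !indic_bool /s (free_ratio mupe)//.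
  by rewrite (free_margz (mupe e))// inE kS orbT.
have S0 : cint (inyc z) (fun w => (\1_[set w | s w] w * j e w)%:E) base = 0%E.
  apply: (etrans (esym (prob_reduced (mupe e) mS fS))).
  apply: measure_negligible => //; apply: negligibleS (ratio_ae1 e).
  by move=> w /= /andP[/eqP].
have nN := nnmeas_indic mN.
have nS : nnmeas (fun w => (\1_[set w | s w] w * j e w)%:E).
  apply: nnmeas_EFin; first by apply: measurable_funM => //; exact: measurable_indic.
  by move=> w; rewrite mulr_ge0.
split => //; rewrite lebXY_cint (cint_perm _ nN uniq_coords (perm_coords z)) cint_cat.
apply: (cint_le0_eq0 (K := fun w =>
  ((\1_[set w | s w] w * j e w)%:E + (defect pe z e w)%:E)%E)).
- exact: cint_nnmeas.
- exact: (nnmeasD nS (nnmeas_defect z mupe e)).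
- move=> w.
  (* The set is a cylinder over (x^z, y), whose fibre in x^{-z} may have infinite Lebesgue measure;
     the factor [+oo] absorbs this. *)
  have -> : cint (outc z) (fun w => (\1_[set w | q w] w)%:E) w =
      ((\1_[set w | q w] w)%:E * cint (outc z) (cst 1%E) w)%E.
    have n1 : nnmeas (cst 1%E : T -> \bar R) by exact: nnmeas_cst.
    have {1}<- := cintZl w n1 (K := fun w => (\1_[set w | q w] w)%:E) nN.2 fN.
    by apply: eq_cint => v; rewrite mule1.
  rewrite indic_bool; have [/andP[me cg]|_] := boolP (q w); last first.
    rewrite mul0e mule_ge0 ?leey// adde_ge0//; first by case: nS.
    by have [_ /(_ w)] := nnmeas_defect z mupe e.
  rewrite gt0_mulye ?leey// -EFinD lte_fin indic_bool /s me andbT.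
  have [je|je] := eqVneq (j e w) 0.
    rewrite je mulr0 add0r /defect je eqxx mul1r mulr_gt0//.
    rewrite lt0r (pooled_ge0 z mupe) andbT eq_sym.
    by move: cg; rewrite /condz je mul0r.
  rewrite /defect (negbTE je) mul0r addr0.
  apply: mulr_gt0; last by rewrite lt0r je j0.
  rewrite ltr0n lt0b; apply: contraNN cg => /eqP r1.
  have cn0 : c e w != 0 by rewrite mulf_neq0 ?invr_eq0 ?(gt_eqF me).
  by rewrite -(divfK cn0 (g w)) -/(ratio pe z e w) r1 mul1r.
- rewrite cintD//; last exact: nnmeas_defect.
  by rewrite S0 add0e; exact: cint_defect0.
Qed.

Lemma env_invariant_gap_le0 : env_invariant pe z.
Proof.
move=> e e'; exists ([set w | (0 < m e w.1) && (c e w != g w)] `|`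
                     [set w | (0 < m e' w.1) && (c e' w != g w)]).
split; first by apply: leb_nullU; exact: condz_pooled_null.
move=> w me me' /not_orP[/= /negP + /negP].
by rewrite me me' /= !negbK => /eqP -> /eqP ->.
Qed.

End zero_gap.

(** The exceptional set has probability 0 under [mu e'], while [j e'] is positive on it. Hence it is
    Lebesgue-null as a set of (x^z, y), and so null for [mu e] as well. *)
Lemma margz0_jointz0_ae e e' : {ae mu e, forall w, m e' w.1 = 0 -> j e' w = 0}.
Proof.
set s := fun w : T => (m e' w.1 == 0) && (j e' w != 0).
have mS : measurable [set w | s w].
  apply: measurable_set_bool; apply: measurable_and.
    exact: measurable_fun_eqr.
  by apply: measurable_neg; exact: measurable_fun_eqr.
have fS : free_of (outc z) (\1_[set w | s w] : T -> R).
  move=> w k t kS; rewrite !indic_bool /s (free_jointz (mupe e'))//.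
  by rewrite (free_margz (mupe e'))// inE kS orbT.
exists [set w | s w]; split => //; last first.
  by move=> w /= /not_implyP[/eqP ? /eqP ?]; exact/andP.
apply: (etrans (prob_reduced (mupe e) mS fS)).
have nS i : nnmeas (fun w => (\1_[set w | s w] w * j i w)%:E).
  apply: nnmeas_EFin; first by apply: measurable_funM => //; exact: measurable_indic.
  by move=> w; rewrite mulr_ge0.
apply: (cint_le0_eq0 (K := fun w => (\1_[set w | s w] w * j e' w)%:E)) => //.
  move=> w; rewrite indic_bool.
  have [sw|_] := boolP (s w); last by rewrite !mul0r mule0.
  rewrite !mul1r gt0_mulye ?leey// lte_fin lt0r j0 andbT.
  by move: sw => /andP[].
apply: (etrans (esym (prob_reduced (mupe e') mS fS))).
apply: measure_negligible => //; apply: negligibleS (margz_ae_gt0 z (mupe e')).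
by move=> w /= /andP[/eqP-> _]; rewrite ltxx.
Qed.

(** Almost surely [j e' w = c e w * m e' w.1] for every [e']: by invariance where the marginal is
    positive, by [margz0_jointz0_ae] where it vanishes. Summing over [e'] and dividing gives
    [g = c e]. *)
Lemma condz_pooled_ae e : env_invariant pe z -> {ae mu e, forall w, c e w = g w}.
Proof.
move=> inv.
have inv_ae e' :
    {ae mu e, forall w, 0 < m e w.1 -> 0 < m e' w.1 -> c e w = c e' w}.
  have [N [N0 NE]] := inv e e'.
  apply: negligibleS (leb_null_prob (mupe e) N0) => w /= h.
  by apply: contrapT => Nw; apply: h => me me'; exact: NE.
have invs :
    {ae mu e, forall w e', 0 < m e w.1 -> 0 < m e' w.1 -> c e w = c e' w}.
  by apply: filter_forall; exact: inv_ae.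
have margs : {ae mu e, forall w e', m e' w.1 = 0 -> j e' w = 0}.
  by apply: filter_forall; exact: margz0_jointz0_ae.
apply: filterS3 (margz_ae_gt0 z (mupe e)) margs invs => w me mj0 cc.
have jE e' : j e' w = c e w * m e' w.1.
  have [me'|] := ltP 0 (m e' w.1).
    by rewrite (cc e' me me') divfK// gt_eqF.
  move=> me'; have {me'}me' : m e' w.1 = 0 by apply/le_anti; rewrite me' m0.
  by rewrite me' mulr0; exact: mj0.
rewrite /pooled; under eq_bigr do rewrite jE.
rewrite -mulr_sumr mulfK// gt_eqF// (bigD1 e)//= ltr_wpDr// sumr_ge0//.
Qed.

Lemma gap_invariant e : env_invariant pe z -> gap pe mu z e = 0.
Proof.
move=> inv; apply/eqP; rewrite subr_eq0; apply/eqP; congr fine.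
apply: ae_eq_integral => //; [exact: measurable_int (int_condz e)|
  exact: measurable_int (int_pooled e)|].
by apply: filterS (condz_pooled_ae e inv) => w /= ->.
Qed.

End invariance.

(** * Events of vanishing probability and measurability *)

Section convergence_in_probability.
Context {R : realType} {d : measure_display} {Omega : measurableType d}.
Variable P : probability Omega R.

Lemma cvg0_prob_sub (A B : nat -> set Omega) :
  (forall n, measurable (A n)) -> (forall n, measurable (B n)) ->
  (\forall n \near \oo, A n `<=` B n) ->
  (P \o B) @ \oo --> 0%E -> (P \o A) @ \oo --> 0%E.
Proof.
move=> mA mB AB B0; apply: (squeeze_cvge _ (cvg_cst 0%E) B0).
apply: filterS AB => n AB; apply/andP; split; first exact: measure_ge0.
by apply: le_measure => //; apply/mem_set.
Qed.

Lemma cvg0_prob_setU (A B : nat -> set Omega) :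
  (forall n, measurable (A n)) -> (forall n, measurable (B n)) ->
  (P \o A) @ \oo --> 0%E -> (P \o B) @ \oo --> 0%E ->
  (fun n => P (A n `|` B n)) @ \oo --> 0%E.
Proof.
move=> mA mB A0 B0.
have AB0 : (fun n => P (A n) + P (B n))%E @ \oo --> 0%E.
  by rewrite -[X in _ --> X]adde0; apply: cvgeD.
apply: (squeeze_cvge _ (cvg_cst 0%E) AB0).
by apply: nearW => n /=; rewrite measure_ge0/= measureU2.
Qed.

Lemma cvg0_prob_bigsetU (I : Type) (s : seq I) (B : I -> nat -> set Omega) :
  (forall i n, measurable (B i n)) -> (forall i, (P \o B i) @ \oo --> 0%E) ->
  (fun n => P (\big[setU/set0]_(i <- s) B i n)) @ \oo --> 0%E.
Proof.
move=> mB B0; elim: s => [|i s ih].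
  under eq_fun do rewrite big_nil measure0; exact: cvg_cst.
under eq_fun do rewrite big_cons.
by apply: cvg0_prob_setU => // n; exact: bigsetU_measurable.
Qed.

Lemma measurable_deviation (X : Omega -> \bar R) (l eps : R) :
  measurable_fun setT X -> measurable [set w | (eps%:E <= `| X w - l%:E |)%E].
Proof.
move=> mX; rewrite -[X in measurable X]setTI.
apply: (emeasurable_fun_c_infty measurableT).
apply: measurableT_comp; first exact: abse_measurable.
exact: emeasurable_funB.
Qed.

Lemma measurable_elog : measurable_fun setT (@elog R).
Proof.
apply: measurable_fun_ifT => //; first exact: measurable_fun_ltr.
by apply/measurable_EFinP; exact: measurable_ln.
Qed.

End convergence_in_probability.

(** * Log-likelihoods and concentration of normalised weights *)

Section log_likelihood.
Context {R : realType} {E n : nat}.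

(** A single nonpositive factor makes the mean [-oo], at infinite distance from [a]. Closeness thus
    forces all factors to be positive, after which [elog] is [ln]. *)
Lemma elog_mean_close (u : 'I_E -> 'I_n -> R) (a eps : R) :
  (0 < n * E)%N ->
  (`| ((n * E)%:R^-1)%:E * \sum_(i < n) \sum_(e < E) elog (u e i) - a%:E |
     < eps%:E)%E ->
  (forall e i, 0 < u e i) /\
  `| (n * E)%:R^-1 * \sum_(e < E) \sum_(i < n) ln (u e i) - a | < eps.
Proof.
move=> nE0; set k := _%:R^-1; have k0 : 0 < k by rewrite invr_gt0 ltr0n.
have [u0|] := pselect (forall e i, 0 < u e i).
  rewrite (eq_bigr (fun i => (\sum_(e < E) ln (u e i))%:E)) => [|i _]; last first.
    by rewrite -sumEFin; apply: eq_bigr => e _; rewrite /elog u0.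
  by rewrite sumEFin -EFinM -EFinB lte_fin exchange_big.
move=> /existsNP[e /existsNP[i /negP u0]].
suff -> : (\sum_(i < n) \sum_(e < E) elog (u e i))%E = -oo%E.
  by rewrite gt0_muleNy ?lte_fin// addNye/= ltNge leey.
apply/esum_eqNyP; exists i; split => //.
apply/esum_eqNyP; exists e; split => //.
by rewrite /elog (negbTE u0).
Qed.

Lemma prod_ratio_expR (u v : 'I_E -> 'I_n -> R) :
  (forall e i, 0 < u e i) -> (forall e i, 0 < v e i) ->
  \prod_(e < E) \prod_(i < n) (u e i / v e i) =
  expR (\sum_(e < E) \sum_(i < n) ln (u e i) -
        \sum_(e < E) \sum_(i < n) ln (v e i)).
Proof.
move=> u0 v0; rewrite -sumrB expR_sum; apply: eq_bigr => e _.
rewrite -sumrB expR_sum; apply: eq_bigr => i _.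
by rewrite expRB !lnK ?posrE.
Qed.

End log_likelihood.

(** As the [pr i] sum to 1, the competitors of [s] have total weight at most [q * W s]; the same
    bound holds for each of them, hence strict inequality when [q < 1]. *)
Lemma posterior_concentration (R : realType) (I : finType) (W pr : I -> R)
    (s : I) (q : R) :
  (forall i, 0 <= pr i) -> \sum_i pr i = 1 -> 0 <= q ->
  (forall i, 0 <= W i) -> 0 < W s ->
  (forall i, i != s -> W i <= q * pr i * W s) ->
  `| W s / \sum_i W i - 1 | <= q /\
  (q < 1 -> forall i, i != s -> W i / \sum_i W i < W s / \sum_i W i).
Proof.
move=> pr0 pr1 q0 W0 Ws WW; set S := \sum_i W i.
have WS : W s <= S by rewrite /S (bigD1 s)//= lerDl sumr_ge0.
have S0 : 0 < S by exact: lt_le_trans WS.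
have SW : S <= W s + q * W s.
  rewrite /S (bigD1 s)//= lerD2l.
  apply: (@le_trans _ _ (\sum_(i | i != s) q * pr i * W s)).
    by apply: ler_sum => i; exact: WW.
  rewrite -mulr_suml -mulr_sumr ler_wpM2r ?(ltW Ws)//.
  by rewrite ler_piMr// -pr1 [leRHS](bigD1 s)//= lerDr.
split.
  rewrite ler0_norm ?subr_le0 ?ler_pdivrMr ?mul1r// opprB lerBlDr -lerBlDl.
  rewrite ler_pdivlMr//.
  (* The claim is now [(1 - q) * S <= W s]: the left side is nonpositive for [q >= 1], and otherwise
     1 - q^2 <= 1 suffices. *)
  have [q1|q1] := ltP q 1; last by nra.
  apply: (@le_trans _ _ ((1 - q) * (W s + q * W s))).
    by rewrite ler_wpM2l//; lra.
  by nra.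
move=> q1 i is_; rewrite ltr_pM2r ?invr_gt0//.
apply: (le_lt_trans (WW i is_)); rewrite -[ltRHS]mul1r ltr_pM2r//.
apply: le_lt_trans q1; rewrite ler_piMr// -pr1 (bigD1 i)//= lerDl.
by rewrite sumr_ge0.
Qed.

(** Divided by [N], the log ratio of z is below [- delta + 2 * eps], and that of the invariant
    selection, whose two limits agree, is above [- 2 * eps]. The difference is below
    [- delta + 4 * eps], which equals [- delta / 2] because [8 * eps = delta]. *)
Lemma weight_ratio_bound (R : realType)
    (N eps delta ps pz Gs Ps Gz Pz ls lz kz : R) :
  0 < N -> 8 * eps = delta -> 0 < ps -> 0 <= pz -> delta <= lz - kz ->
  `|N^-1 * Ps - ls| < eps -> `|N^-1 * Gs - ls| < eps ->
  `|N^-1 * Pz - lz| < eps -> `|N^-1 * Gz - kz| < eps ->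
  pz * expR (Gz - Pz) <=
    (ps^-1 * expR (- (N * (delta / 2)))) * pz * (ps * expR (Gs - Ps)).
Proof.
move=> N0 <- ps0 pz0 dl.
have NK x : N * (N^-1 * x) = x by rewrite mulVKf// gt_eqF.
rewrite -{2}(NK Gz) -{2}(NK Pz) -{2}(NK Gs) -{2}(NK Ps).
move: (_ * Ps) (_ * Gs) (_ * Pz) (_ * Gz) => a b c' d'.
rewrite !ltr_norml => /andP[a1 a2] /andP[b1 b2] /andP[c1 c2] /andP[d1 d2].
rewrite [leRHS](_ : _ = pz * (expR (- (N * (8 * eps / 2))) *
  expR (N * b - N * a))); last first.
  by field; rewrite gt_eqF.
rewrite ler_wpM2l// -expRD ler_expR -!mulrBr -mulrN -mulrDr ler_pM2l//.
lra.
Qed.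

Lemma finite_gap (R : realType) (I : finType) (Q : pred I) (D : I -> R) :
  (forall i, Q i -> 0 < D i) ->
  exists2 delta, 0 < delta & forall i, Q i -> delta <= D i.
Proof.
(* Starting the minimum at 1 covers an empty [Q]. *)
move=> D0; exists (\big[Num.min/1]_(i | Q i) D i); first exact: lt_bigmin.
by move=> i Qi; exact: bigmin_le_cond.
Qed.

(** * Posterior consistency for a fixed number of environments *)

Unset Implicit Arguments.
Set Strict Implicit.

Theorem theorem3
  (R : realType) (p E : nat) (HE : (0 < E)%N)
  (d : measure_display) (Omega : measurableType d) (P : probability Omega R)
  (* environment distributions p_e(x,y), with Lebesgue densities pe e *)
  (pe : 'I_E -> p.-tuple R * R -> R)
  (mu : 'I_E -> probability (p.-tuple R * R)%type R)
  (Hdens : forall e, has_density (mu e) (pe e))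
  (* data: for each n, (x_ei, y_ei), e < E, i < n, independent, law p_e *)
  (X : forall n : nat, 'I_E -> 'I_n -> Omega -> p.-tuple R * R)
  (HXmeas : forall n e i, measurable_fun setT (X n e i))
  (HXlaw : forall n e i A, measurable A -> P (X n e i @^-1` A) = mu e A)
  (HXind : forall n, indep_data P (X n))
  (* prior on {0,1}^p *)
  (prior : selector p -> R)
  (Hprior0 : forall z, 0 <= prior z)
  (Hprior1 : \sum_(z : selector p) prior z = 1)
  (* model classes and maximum-likelihood estimators *)
  (Pcls : selector p -> set (p.-tuple R -> R -> R))
  (HPcls : forall z q, Pcls z q -> is_cond_density z q)
  (phat : 'I_E -> selector p -> nat -> Omega -> p.-tuple R -> R -> R)
  (ghat : selector p -> nat -> Omega -> p.-tuple R -> R -> R)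
  (Hphat_in : forall e z n w, Pcls z (phat e z n w))
  (Hphat_ml : forall e z n w q, Pcls z q ->
     \prod_(i < n) q (X n e i w).1 (X n e i w).2 <=
     \prod_(i < n) phat e z n w (X n e i w).1 (X n e i w).2)
  (Hghat_in : forall z n w, Pcls z (ghat z n w))
  (Hghat_ml : forall z n w q, Pcls z q ->
     \prod_(e < E) \prod_(i < n) q (X n e i w).1 (X n e i w).2 <=
     \prod_(e < E) \prod_(i < n) ghat z n w (X n e i w).1 (X n e i w).2)
  (Hmeas_p : forall n e z (i : 'I_n),
     measurable_fun setT (fun w => phat e z n w (X n e i w).1 (X n e i w).2))
  (Hmeas_g : forall n e z (i : 'I_n),
     measurable_fun setT (fun w => ghat z n w (X n e i w).1 (X n e i w).2))
  (* Invariance and uniqueness *)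
  (zstar : selector p)
  (Hinv : env_invariant pe zstar)
  (Huniq : forall z, env_invariant pe z -> z = zstar)
  (* Prior positivity *)
  (Hprior_star : 0 < prior zstar)
  (* the limiting expectations are finite *)
  (Hint : forall z, 0 < prior z -> forall e,
     (mu e).-integrable setT (fun w => (ln (condz (pe e) z w))%:E) /\
     (mu e).-integrable setT (fun w => (ln (pooled pe z w))%:E))
  (* Estimation consistency given fixed environments *)
  (Hcons_p : forall z, 0 < prior z ->
     cvg_in_prob P
       (fun n w => (((n * E)%:R)^-1)%:E *
          \sum_(i < n) \sum_(e < E)
             elog (phat e z n w (X n e i w).1 (X n e i w).2))%E
       (Eenv mu (fun e w => ln (condz (pe e) z w))))
  (Hcons_g : forall z, 0 < prior z ->
     cvg_in_prob P
       (fun n w => (((n * E)%:R)^-1)%:E *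
          \sum_(i < n) \sum_(e < E)
             elog (ghat z n w (X n e i w).1 (X n e i w).2))%E
       (Eenv mu (fun e w => ln (pooled pe z w)))) :
  (* (i) any (measurable) argmax of the estimated posterior -> z* in prob. *)
  (forall zhat : nat -> Omega -> selector p,
     (forall n z, measurable [set w | zhat n w = z]) ->
     (forall n w z, bip_post prior phat ghat (X n) w z <=
                    bip_post prior phat ghat (X n) w (zhat n w)) ->
     (fun n => P [set w | zhat n w <> zstar]) @ \oo --> 0%E)
  /\
  (* (ii) the estimated posterior of z* -> 1 in probability *)
  cvg_in_prob P (fun n w => (bip_post prior phat ghat (X n) w zstar)%:E) 1.
Proof.
have nE n : (0 < n)%N -> (0 < n * E)%N by move=> n0; rewrite muln_gt0 n0.
pose a z := Eenv mu (fun e w => ln (condz (pe e) z w)).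
pose b z := Eenv mu (fun e w => ln (pooled pe z w)).
have abE z : a z - b z = E%:R^-1 * \sum_(e < E) gap pe mu z e.
  by rewrite /a /b /Eenv -mulrBr -sumrB.
have E0 : 0 < E%:R^-1 :> R by rewrite invr_gt0 ltr0n.
have ab_star : a zstar = b zstar.
  apply/eqP; rewrite -subr_eq0 abE big1 ?mulr0// => e _.
  by apply: gap_invariant => // e'; have [] := Hint zstar Hprior_star e'.
(* A nonpositive total gap would make z invariant, hence equal to [zstar] by uniqueness. *)
have ab_gt0 z : (z != zstar) && (0 < prior z) -> 0 < a z - b z.
  move=> /andP[zs pz]; rewrite abE mulr_gt0// ltNge; apply/negP => gap0.
  move/eqP: zs; apply; apply: Huniq; apply: (env_invariant_gap_le0 Hdens _ _ gap0).
  - by move=> e; have [] := Hint z pz e.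
  - by move=> e; have [] := Hint z pz e.
have [delta delta0 delta_le] := finite_gap ab_gt0.
pose eps := delta / 8.
have eps0 : 0 < eps by rewrite divr_gt0.
have eps8 : 8 * eps = delta by rewrite /eps; field.
pose A n z w := (((n * E)%:R^-1)%:E * \sum_(i < n) \sum_(e < E)
  elog (phat e z n w (X n e i w).1 (X n e i w).2))%E.
pose B n z w := (((n * E)%:R^-1)%:E * \sum_(i < n) \sum_(e < E)
  elog (ghat z n w (X n e i w).1 (X n e i w).2))%E.
have mA n z : measurable_fun setT (A n z).
  apply: measurable_funeM; apply: emeasurable_sum => i; apply: emeasurable_sum => e.
  exact: (measurableT_comp (@measurable_elog R) (Hmeas_p n e z i)).
have mB n z : measurable_fun setT (B n z).
  apply: measurable_funeM; apply: emeasurable_sum => i; apply: emeasurable_sum => e.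
  exact: (measurableT_comp (@measurable_elog R) (Hmeas_g n e z i)).
(* Consistency is assumed for positive prior only; a selection of zero prior has weight 0 whatever
   its estimators are, so its bad event is empty. *)
pose Bad_at z n := if 0 < prior z then
  [set w | (eps%:E <= `| A n z w - (a z)%:E |)%E] `|`
  [set w | (eps%:E <= `| B n z w - (b z)%:E |)%E] else set0.
have mBad_at z n : measurable (Bad_at z n).
  rewrite /Bad_at; case: ifP => // _.
  by apply: measurableU; exact: measurable_deviation.
have Bad_at0 z : (P \o Bad_at z) @ \oo --> 0%E.
  rewrite /Bad_at; have [pz|_] := boolP (0 < prior z); last first.
    rewrite (_ : P \o _ = cst 0%E); first exact: cvg_cst.
    by apply/funext => n /=; exact: measure0.
  apply: cvg0_prob_setU.
  - by move=> n; exact: measurable_deviation.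
  - by move=> n; exact: measurable_deviation.
  - exact: Hcons_p.
  - exact: Hcons_g.
(* There are finitely many selections, so the union still has vanishing probability. *)
pose Bad n := \big[setU/set0]_(z : selector p) Bad_at z n.
have mBad n : measurable (Bad n) by apply: bigsetU_measurable => z _.
have Bad0 : (P \o Bad) @ \oo --> 0%E by exact: cvg0_prob_bigsetU.
(* The first factor in the bound of [weight_ratio_bound] with [N = n * E]; for fixed [E] it is
   geometric in n. *)
pose q n := geometric (prior zstar)^-1 (expR (- (E%:R * (delta / 2)))) n.
have q_small tau : 0 < tau -> \forall n \near \oo, (0 < n)%N /\ q n < tau.
  move=> tau0.
  have q0 : q @ \oo --> 0.
    apply: cvg_geometric; rewrite ger0_norm ?expR_ge0// expR_lt1 oppr_lt0.
    by rewrite mulr_gt0 ?divr_gt0// ltr0n.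
  near=> n; split; first by near: n; exact: nbhs_infty_gt.
  by near: n; exact: (cvgr_lt _ q0).
have qE n : q n = (prior zstar)^-1 * expR (- ((n * E)%:R * (delta / 2))).
  by rewrite /q /geometric/= -expRM_natl natrM mulrN (mulrA n%:R).
have q_ge0 n : 0 <= q n by rewrite qE mulr_ge0 ?expR_ge0// invr_ge0.
have weight0 n w z : 0 <= bip_weight prior phat ghat (X n) w z.
  rewrite mulr_ge0// prodr_ge0// => e _; rewrite prodr_ge0// => i _.
  apply: divr_ge0; first by have [] := HPcls _ _ (Hghat_in z n w).
  by have [] := HPcls _ _ (Hphat_in e z n w).
have good n w : (0 < n)%N -> ~ Bad n w ->
    `| bip_post prior phat ghat (X n) w zstar - 1 | <= q n /\
    (q n < 1 -> forall z, z != zstar -> bip_post prior phat ghat (X n) w z <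
      bip_post prior phat ghat (X n) w zstar).
  move=> n0 nBad.
  have close z : 0 < prior z -> exists G L : R,
      [/\ bip_weight prior phat ghat (X n) w z = prior z * expR (G - L),
          `|(n * E)%:R^-1 * L - a z| < eps & `|(n * E)%:R^-1 * G - b z| < eps].
    move=> pz.
    have nBz : ~ Bad_at z n w.
      move=> Bz; apply: nBad; rewrite /Bad -bigcup_seq.
      by exists z => //=; rewrite mem_index_enum.
    move: nBz; rewrite /Bad_at pz => /not_orP[/= /negP + /negP]; rewrite -!ltNge.
    move=> /(elog_mean_close (nE n n0))[p0 pc] /(elog_mean_close (nE n n0))[g0 gc].
    do 2 eexists; split; [|exact: pc|exact: gc].
    by rewrite /bip_weight prod_ratio_expR.
  have [Gs [Ls [Ws Lsa Gsb]]] := close _ Hprior_star.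
  apply: (posterior_concentration Hprior0 Hprior1 (q_ge0 n)) => //.
    by rewrite Ws mulr_gt0// expR_gt0.
  move=> z zs; have [pz|] := ltP 0 (prior z); last first.
    move=> pz; have {}pz : prior z = 0 by apply/le_anti; rewrite pz Hprior0.
    by rewrite /bip_weight pz !mul0r mulr0 mul0r.
  have [G [L [-> La Gb]]] := close _ pz; rewrite Ws qE.
  apply: (weight_ratio_bound _ eps8 _ _ _ Lsa _ La Gb) => //.
  - by rewrite ltr0n nE.
  - by apply: delta_le; rewrite zs.
  - by rewrite ab_star.
have mpost n z : measurable_fun setT (fun w => bip_post prior phat ghat (X n) w z).
  have mw z' : measurable_fun setT (fun w => bip_weight prior phat ghat (X n) w z').
    apply: measurable_funM => //.
    apply: measurable_prod => e _; apply: measurable_prod => i _.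
    apply: measurable_funM; first exact: Hmeas_g.
    apply: measurable_funV_ge0; first exact: Hmeas_p.
    by move=> w; have [] := HPcls _ _ (Hphat_in e z' n w).
  apply: measurable_funM; first exact: mw.
  apply: measurable_funV_ge0; first exact: measurable_sum.
  by move=> w; rewrite sumr_ge0.
split.
  move=> zhat mzhat zhat_max; apply: (cvg0_prob_sub _ mBad _ Bad0).
    by move=> n; apply: measurableC; exact: mzhat.
  (* Once [q n < 1], [zstar] is the strict maximiser off the bad event, so no tie can affect
     [zhat]. *)
  apply: filterS (q_small 1 ltr01) => n [n0 q1] w /= /eqP zs.
  apply: contrapT => /(good n w n0)[_ /(_ q1 _ zs)].
  by rewrite ltNge zhat_max.
move=> tau tau0; apply: (cvg0_prob_sub _ mBad _ Bad0).
  by move=> n; apply: measurable_deviation; exact/measurable_EFinP.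
apply: filterS (q_small tau tau0) => n [n0 qtau] w /=.
rewrite lee_fin => far; apply: contrapT => /(good n w n0)[close _].
by move: (le_lt_trans close qtau); rewrite ltNge far.
Unshelve. all: by end_near. Qed.
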